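(* Let $d\ge 1$, let $S \subseteq \mathbb{R}^d$ be a Meyer set with covering radius $R$, and let $U = (S+S-S) \cap B_R$. Define for every real $T \geq 0$ the set $H_T = U \cup (S \cap B_T)$. If $$\liminf_{T \rightarrow \infty} \frac{N_S(T)}{T^d}=0,$$ then $S$ has low complexity with respect to $H_T$ for some $T$, that is, $P_S(H_T) \leq |H_T|$ for some $T\ge 0$.
   Context: $B_T(\mathbf{u})$ denotes the closed Euclidean ball of radius $T$ centered at $\mathbf{u}\in\mathbb{R}^d$, and $B_T = B_T(\mathbf{0})$. A set $S\subseteq\mathbb{R}^d$ is uniformly discrete if there is $r>0$ such that every open ball of radius $r$ contains at most one point of $S$, and relatively dense if there is $R>0$ such that every closed ball of radius $R$ contains at least one point of $S$. A Delone set is a set that is both uniformly discrete and relatively dense; the smallest possible such $R$ is its covering radius. A Delone set $S$ is a Meyer set if $S-S=\{\mathbf{s}-\mathbf{s}' \mid \mathbf{s},\mathbf{s}'\in S\}$ is also a Delone set. Here $S+S-S=\{\mathbf{s}_1+\mathbf{s}_2-\mathbf{s}_3\mid \mathbf{s}_i\in S\}$. The patch-counting function is $N_S(T) = |\{ (S-\mathbf{s}) \cap B_T \mid \mathbf{s} \in S \}|$. For a non-empty finite set $D\subseteq\mathbb{R}^d$, the pattern complexity of $S$ with respect to $D$ is $P_S(D) = |\{(S-\mathbf{t})\cap D \mid \mathbf{t}\in\mathbb{R}^d\}|$; $S$ has low complexity with respect to $D$ if $P_S(D)\le |D|$. *)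

(* Defs.v *)
From HB Require Import structures.
From mathcomp Require Import all_boot all_order all_algebra.
From mathcomp Require Import all_classical all_reals all_analysis.
Set Implicit Arguments.
Unset Strict Implicit.
Unset Printing Implicit Defensive.
Import Order.TTheory GRing.Theory Num.Theory.
Import numFieldNormedType.Exports.
Local Open Scope classical_set_scope.
Local Open Scope ring_scope.

Section Delone.
Variables (R : realType) (d : nat).
Implicit Types (S D : set 'rV[R]_d) (u s t : 'rV[R]_d) (r T : R).

(* The library norm on 'rV[R]_d is the sup norm, hence this definition. *)
Definition enorm u : R := Num.sqrt (\sum_(i < d) u ord0 i ^+ 2).

Definition open_eball u r : set 'rV[R]_d := [set x | enorm (x - u) < r].

(* B_r(u); empty when r < 0. *)
Definition closed_eball u r : set 'rV[R]_d := [set x | enorm (x - u) <= r].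

Definition uniformly_discrete S : Prop :=
  exists2 r : R, 0 < r &
    forall u x y, (S `&` open_eball u r) x -> (S `&` open_eball u r) y -> x = y.

Definition covers S r : Prop := forall u, S `&` closed_eball u r !=set0.

Definition relatively_dense S : Prop := exists2 r : R, 0 < r & covers S r.

Definition delone S : Prop := uniformly_discrete S /\ relatively_dense S.

Definition is_covering_radius S r : Prop :=
  [/\ 0 < r, covers S r & forall r', 0 < r' -> covers S r' -> r <= r'].

Definition diff_set S : set 'rV[R]_d := [set s - s' | s in S & s' in S].

Definition meyer S : Prop := delone S /\ delone (diff_set S).

Definition sum_diff_set S : set 'rV[R]_d :=
  [set x - s | x in [set s1 + s2 | s1 in S & s2 in S] & s in S].

Definition shift S t : set 'rV[R]_d := [set s - t | s in S].

(* [counting] is the cardinality with values in \bar R (+oo on infinite sets),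
   so no finiteness is presupposed here. *)
Definition patch_count S T : \bar R :=
  counting [set shift S s `&` closed_eball 0 T | s in S].

Definition pattern_complexity S D : \bar R :=
  counting [set shift S t `&` D | t in [set: 'rV[R]_d]].

(* Pattern complexity is only considered for non-empty finite D; requiring this
   also excludes the degenerate comparison +oo <= +oo. *)
Definition low_complexity S D : Prop :=
  [/\ finite_set D, D !=set0 & (pattern_complexity S D <= counting D)%E].

(* H_T, where r stands for the covering radius of S. *)
Definition patch_support S r T : set 'rV[R]_d :=
  (sum_diff_set S `&` closed_eball 0 r) `|` (S `&` closed_eball 0 T).

End Delone.

(* Main.v *)
(* With [U = (S + S - S) `&` B_r], every [t] whose pattern on [H_T] is nonempty is
   [s - u] with [s] in [S] and [u] in [U], and for [r <= T] its pattern is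
   determined by [u] and the patch of radius [T + r] at [s]; hence
   [P_S(H_T) <= 1 + #U * N_S(T + r)].  On the other hand [S] meets each of a grid
   of disjoint balls, so [H_T] has at least a constant times [T ^ d] points, and
   the hypothesis on the liminf provides a suitable [T].  That [U] is finite is
   Lagarias' theorem: a point [s1 + s2 - s3] near [c] in [S] gives almost parallel
   segments from [s3] to [s1] and from [s2] to [c]; sliding the first along [S] to
   the second changes the difference of its end points by finitely many
   increments, and these differences take boundedly many values. *)
Require Import Defs.
From HB Require Import structures.
From mathcomp Require Import all_boot all_order all_algebra.
From mathcomp Require Import all_classical all_reals all_analysis.
From mathcomp Require Import finmap ring lra.
Set Implicit Arguments.
Unset Strict Implicit.
Unset Printing Implicit Defensive.
Import Order.TTheory GRing.Theory Num.Theory.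
Import numFieldNormedType.Exports.
Local Open Scope classical_set_scope.
Local Open Scope ring_scope.

(** * The Euclidean norm on row vectors *)

Lemma enorm_ge0 (R : realType) (d : nat) (x : 'rV[R]_d) : 0 <= enorm x.
Proof. exact: sqrtr_ge0. Qed.

Lemma sqr_enorm (R : realType) (d : nat) (x : 'rV[R]_d) :
  enorm x ^+ 2 = \sum_(i < d) x ord0 i ^+ 2.
Proof. by rewrite sqr_sqrtr // sumr_ge0 // => i _; rewrite sqr_ge0. Qed.

Lemma enormN (R : realType) (d : nat) (x : 'rV[R]_d) : enorm (- x) = enorm x.
Proof.
by congr Num.sqrt; apply: eq_bigr => i _; rewrite mxE sqrrN.
Qed.

Lemma enormB (R : realType) (d : nat) (x y : 'rV[R]_d) :
  enorm (x - y) = enorm (y - x).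
Proof. by rewrite -enormN opprB. Qed.

Lemma enormZ (R : realType) (d : nat) (a : R) (x : 'rV[R]_d) :
  enorm (a *: x) = `|a| * enorm x.
Proof.
rewrite -sqrtr_sqr -sqrtrM ?sqr_ge0 // mulr_sumr; congr Num.sqrt.
by apply: eq_bigr => i _; rewrite mxE exprMn.
Qed.

Lemma coord_le_enorm (R : realType) (d : nat) (x : 'rV[R]_d) (i : 'I_d) :
  `|x ord0 i| <= enorm x.
Proof.
rewrite -(ler_pXn2r (n := 2)) ?nnegrE ?enorm_ge0 // sqr_enorm real_normK ?num_real //.
by rewrite (bigD1 i) //= lerDl sumr_ge0 // => j _; rewrite sqr_ge0.
Qed.

Lemma enorm_eq0 (R : realType) (d : nat) (x : 'rV[R]_d) : enorm x = 0 -> x = 0.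
Proof.
move=> x0; apply/rowP => i; rewrite mxE; apply/eqP.
by rewrite -normr_le0 -x0 coord_le_enorm.
Qed.

(** With [a = enorm x] and [b = enorm y], the sum of the squares of [b * x_i - a * y_i] is
    [2 * a * b] times the difference of the two sides. *)
Lemma cauchy_schwarz (R : realType) (d : nat) (x y : 'rV[R]_d) :
  \sum_(i < d) x ord0 i * y ord0 i <= enorm x * enorm y.
Proof.
have [x0|x_neq0] := eqVneq (enorm x) 0.
  rewrite x0 mul0r big1 // => i _.
  by rewrite (enorm_eq0 x0) mxE mul0r.
have [y0|y_neq0] := eqVneq (enorm y) 0.
  rewrite y0 mulr0 big1 // => i _.
  by rewrite (enorm_eq0 y0) mxE mulr0.
set a := enorm x in x_neq0 *; set b := enorm y in y_neq0 *.
have ab_gt0 : 0 < a * b by rewrite mulr_gt0 // lt0r ?x_neq0 ?y_neq0 enorm_ge0.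
have : 0 <= \sum_(i < d) (b * x ord0 i - a * y ord0 i) ^+ 2.
  by apply: sumr_ge0 => i _; rewrite sqr_ge0.
rewrite (eq_bigr (fun i => b ^+ 2 * x ord0 i ^+ 2 + a ^+ 2 * y ord0 i ^+ 2 -
  2 * (a * b) * (x ord0 i * y ord0 i))); last by move=> i _; ring.
rewrite sumrB big_split /= -!mulr_sumr -!sqr_enorm -/a -/b => sq_ge0.
rewrite -(ler_pM2l ab_gt0); lra.
Qed.

Lemma ler_enormD (R : realType) (d : nat) (x y : 'rV[R]_d) :
  enorm (x + y) <= enorm x + enorm y.
Proof.
rewrite -(ler_pXn2r (n := 2)) ?nnegrE ?addr_ge0 ?enorm_ge0 // sqr_enorm.
rewrite (eq_bigr (fun i => x ord0 i ^+ 2 + y ord0 i ^+ 2 +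
  2 * (x ord0 i * y ord0 i))); last by move=> i _; rewrite mxE; ring.
rewrite !big_split /= -mulr_sumr -!sqr_enorm.
by have := cauchy_schwarz x y; lra.
Qed.

Lemma ler_enormB (R : realType) (d : nat) (x y : 'rV[R]_d) :
  enorm (x - y) <= enorm x + enorm y.
Proof. by rewrite -[enorm y]enormN ler_enormD. Qed.

Lemma ler_enorm_distD (R : realType) (d : nat) (z x y : 'rV[R]_d) :
  enorm (x - y) <= enorm (x - z) + enorm (z - y).
Proof. by rewrite -[x - y](subrKA z) ler_enormD. Qed.

Lemma enorm_le_coord (R : realType) (d : nat) (x : 'rV[R]_d) (c : R) :
  (forall i, `|x ord0 i| <= c) -> enorm x <= d%:R * c.
Proof.
move=> xc.
(* For [d = 0] the sign of [c] is unknown, but both sides vanish. *)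
have [i|d0] := pickP 'I_d; last first.
  have -> : x = 0 by apply/rowP => i; have := d0 i.
  rewrite /enorm big1 ?sqrtr0 => [|i _]; last by have := d0 i.
  by case: (d) d0 => [_|n /(_ ord0)//]; rewrite mul0r.
move=> _; have c0 : 0 <= c := le_trans (normr_ge0 _) (xc i).
have d1 : 1 <= d%:R :> R by rewrite ler1n; case: (d) i => // -[].
rewrite -(ler_pXn2r (n := 2)) ?nnegrE ?mulr_ge0 ?ler0n ?enorm_ge0 //.
rewrite sqr_enorm exprMn (le_trans (y := \sum_(i < d) c ^+ 2)) //.
  by apply: ler_sum => j _; rewrite -real_normK ?num_real // ler_pXn2r ?nnegrE.
rewrite sumr_const card_ord -[leLHS]mulr_natl ler_wpM2r ?sqr_ge0 //.
by rewrite expr2 ler_peMl // ler0n.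
Qed.

(** * Packing bounds for uniformly discrete sets *)

(** Pigeonhole on a grid of cubes so small that each holds at most one point of [Y]; the number of
    cubes does not depend on the centre [v]. *)
Lemma uniformly_discrete_packing (R : realType) (d : nat) (Y : set 'rV[R]_d)
    (K : R) : uniformly_discrete Y ->
  exists M : nat, forall (v : 'rV[R]_d) (s : seq 'rV[R]_d), uniq s ->
    (forall x, x \in s -> (Y `&` closed_eball v K) x) -> (size s <= M)%N.
Proof.
move=> [rho rho_gt0 discY].
(* Points in one cube of side [delta] are at distance at most [d * delta], which is strictly below
   [rho] thanks to the successor. *)
pose delta := rho / d.+1%:R.
have delta_gt0 : 0 < delta by rewrite divr_gt0.
pose N := Num.trunc (2 * K / delta).
exists #|{ffun 'I_d -> 'I_N.+1}| => v s s_uniq sYK.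
pose cell (x : 'rV[R]_d) (i : 'I_d) := (x ord0 i - v ord0 i + K) / delta.
pose f x := [ffun i => inord (Num.trunc (cell x i)) : 'I_N.+1].
have cellP x i : x \in s -> 0 <= cell x i <= 2 * K / delta.
  move=> /sYK[_ xK]; have := coord_le_enorm (x - v) i.
  rewrite !mxE => /le_trans/(_ xK); rewrite ler_norml => /andP[lo hi].
  by rewrite /cell divr_ge0 ?(ltW delta_gt0) ?ler_pM2r ?invr_gt0 //; lra.
have f_inj : {in s &, injective f}.
  move=> x y xs ys fxy.
  apply: (discY y); last first.
  - split; first by case: (sYK _ ys).
    rewrite /open_eball /= subrr /enorm big1 ?sqrtr0 // => i _.
    by rewrite mxE expr0n.
  split; first by case: (sYK _ xs).
  suff /enorm_le_coord : forall i, `|(x - y) ord0 i| <= delta.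
    move=> /le_lt_trans; apply.
    by rewrite mulrC -mulrA gtr_pMr // mulrC ltr_pdivrMr // mul1r ltr_nat.
  move=> i; have /andP[x0 xN] := cellP _ i xs; have /andP[y0 yN] := cellP _ i ys.
  have : Num.trunc (cell x i) = Num.trunc (cell y i).
    have := congr1 (fun g : {ffun 'I_d -> 'I_N.+1} => nat_of_ord (g i)) fxy.
    by rewrite !ffunE !inordK // ltnS le_truncn.
  have := truncn_itv x0; have := truncn_itv y0.
  move=> yT xT cxy; move: xT yT; rewrite cxy -natr1 => /andP[xl xu] /andP[yl yu].
  have : `|cell x i - cell y i| <= 1 by rewrite ler_norml; lra.
  rewrite -mulrBl normrM normfV (gtr0_norm delta_gt0) ler_pdivrMr // mul1r.
  by rewrite !mxE; congr (`|_| <= _); ring.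
rewrite -(size_map f) -(card_uniqP _) ?max_card //.
by rewrite map_inj_in_uniq.
Qed.

Lemma uniformly_discrete_finite (R : realType) (d : nat) (Y : set 'rV[R]_d)
    (v : 'rV[R]_d) (K : R) :
  uniformly_discrete Y -> finite_set (Y `&` closed_eball v K).
Proof.
move=> /(uniformly_discrete_packing K)[M packM]; apply: contrapT => infY.
have [B BY] := infinite_set_fset M.+1 infY.
by rewrite ltnNge (packM v) ?fset_uniq // => x xB; apply: BY.
Qed.

(** * Chains with finitely many increments *)

Lemma path_sum_increments (V : zmodType) (G : set V) (x : V) (p : seq V) :
  path (fun y z => `[< G (z - y) >]) x p ->
  exists2 g : seq V, (forall z, z \in g -> G z) /\ size g = size p &
    last x p = x + \sum_(z <- g) z.
Proof.
elim: p x => [|y p IHp] x /=; first by exists [::]; rewrite ?big_nil ?addr0.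
move=> /andP[/asboolP Gyx /IHp[g [gG sz_g] ->]].
exists ((y - x) :: g); last by rewrite big_cons addrA subrKC.
split; last by rewrite /= sz_g.
by move=> z; rewrite inE => /predU1P[->//|/gG].
Qed.

Lemma finite_bounded_sums (V : zmodType) (G : set V) (M : nat) :
  finite_set G ->
  finite_set [set \sum_(z <- g) z | g in
    [set g : seq V | (forall z, z \in g -> G z) /\ (size g <= M)%N]].
Proof.
move=> finG; elim: M => [|M IHM].
  apply: (sub_finite_set _ (finite_set1 0)) => x [g [_]].
  by rewrite leqn0 size_eq0 => /eqP -> <-; rewrite big_nil.
(* Adjoining 0 lets the empty sum count as a sum with one more term. *)
have finG0 : finite_set (G `|` [set 0]) by rewrite finite_setU.
apply: sub_finite_set (finite_image2 (fun x y => x + y) finG0 IHM).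
move=> x [[|z g] [gG sz_g] <-].
  exists 0; first by right.
  by exists 0; [exists [::]; rewrite ?big_nil | rewrite big_nil addr0].
exists z; first by left; apply: gG; rewrite mem_head.
exists (\sum_(z <- g) z); last by rewrite big_cons.
by exists g => //; split=> // y yg; apply: gG; rewrite inE yg orbT.
Qed.

(* Lagarias' argument: consecutive terms differ by an element of a finite set,
   and all terms lie in one ball, which contains at most [M] points of [Y]; so
   after removing loops the chain has at most [M] steps, whatever its length. *)
Lemma finite_chain_increments (R : realType) (d : nat) (Y : set 'rV[R]_d)
    (G : set 'rV[R]_d) (K : R) : uniformly_discrete Y -> finite_set G ->
  finite_set [set w | exists2 y : nat -> 'rV[R]_d,
    (forall i, Y (y i) /\ enorm (y i - y 0%N) <= K) /\ (forall i, G (y i.+1 - y i)) &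
    exists n, w = y n - y 0%N].
Proof.
move=> discY finG; have [M packM] := uniformly_discrete_packing K discY.
apply: (sub_finite_set _ (finite_bounded_sums M finG)) => w [y [yY yG] [n ->]].
pose e (u v : 'rV[R]_d) := `[< G (v - u) >].
have e_path m k : path e (y m) (map y (iota m.+1 k)).
  by elim: k m => [|k IHk] m //=; rewrite IHk andbT; apply/asboolP.
have e_last m k : last (y m) (map y (iota m.+1 k)) = y (m + k)%N.
  by elim: k m => [|k IHk] m /=; rewrite ?addn0 // IHk addSnnS.
rewrite -(e_last 0%N n); case: (shortenP (e_path 0%N n)) => p p_path p_uniq p_sub.
have [g [gG sz_g] ->] := path_sum_increments p_path.
exists g; last by rewrite addrC addKr.
split=> //; rewrite sz_g.
rewrite (packM (y 0%N)) //; first by case/andP: p_uniq.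
by move=> x /p_sub/mapP[i _ ->]; apply: yY.
Qed.

(** * Finiteness of [S + S - S] in a ball *)

(** The trail in [S] shadows the segment from [x] to [x + w]: inner points come from the covering
    property, while both ends are prescribed. *)
Lemma covers_trail (R : realType) (d : nat) (S : set 'rV[R]_d) (r K : R)
    (x y w : 'rV[R]_d) (n : nat) :
  covers S r -> r <= K -> S x -> S y -> enorm (y - (x + w)) <= K ->
  (0 < n)%N ->
  exists a : nat -> 'rV[R]_d, [/\ forall i, S (a i),
    forall i, enorm (a i - (x + (i%:R / n%:R) *: w)) <= K, a 0%N = x & a n = y].
Proof.
move=> covS rK Sx Sy yxw n_gt0.
have K0 : 0 <= K := le_trans (enorm_ge0 _) yxw.
have /choice[a aP] : forall i : nat, exists a, [/\ S a,
    enorm (a - (x + (i%:R / n%:R) *: w)) <= K, i = 0%N -> a = x & i = n -> a = y].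
  move=> i; have [->|i0] := eqVneq i 0%N.
    exists x; split=> // [|n0]; last by rewrite -n0 in n_gt0.
    by rewrite mul0r scale0r addr0 subrr -(scale0r 0) enormZ normr0 mul0r.
  have [->|i_n] := eqVneq i n.
    exists y; split=> // [|n0]; last by rewrite n0 in n_gt0.
    by rewrite divff ?scale1r // pnatr_eq0 -lt0n.
  have [s [Ss sK]] := covS (x + (i%:R / n%:R) *: w).
  exists s; split=> // [|/eqP|/eqP].
  - exact: le_trans rK.
  - by rewrite (negPf i0).
  - by rewrite (negPf i_n).
exists a; split=> [i|i||].
- by have [] := aP i.
- by have [] := aP i.
- by have [_ _ a0 _] := aP 0%N; exact: a0.
- by have [_ _ _ an] := aP n; exact: an.
Qed.

(** Consecutive nodes of the segment are at most 1 apart, and each of the two trail points is within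
    [K] of its node. *)
Lemma trail_step (R : realType) (d : nat) (a : nat -> 'rV[R]_d)
    (x w : 'rV[R]_d) (K : R) (n i : nat) :
  (forall i, enorm (a i - (x + (i%:R / n%:R) *: w)) <= K) ->
  enorm w <= n%:R -> enorm (a i.+1 - a i) <= 2 * K + 1.
Proof.
move=> aK wn.
apply: le_trans (ler_enorm_distD (x + (i.+1%:R / n%:R) *: w) _ _) _.
apply: le_trans (lerD (aK i.+1) (ler_enorm_distD (x + (i%:R / n%:R) *: w) _ _)) _.
have step1 : enorm (x + (i.+1%:R / n%:R) *: w - (x + (i%:R / n%:R) *: w)) <= 1.
  rewrite opprD addrACA subrr add0r -scalerBl -mulrBl -natr1 addrAC subrr add0r.
  rewrite enormZ mul1r ger0_norm ?invr_ge0 ?ler0n // mulrC.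
  have [->|n0] := eqVneq n 0%N; first by rewrite invr0 mulr0 ler01.
  by rewrite ler_pdivrMr ?ltr0n ?lt0n // mul1r.
by have := aK i; rewrite enormB; lra.
Qed.

Lemma finite_sum_diff_set_ball (R : realType) (d : nat) (S : set 'rV[R]_d)
    (r K : R) : 0 <= K -> covers S r -> uniformly_discrete (diff_set S) ->
  finite_set (sum_diff_set S `&` closed_eball 0 K).
Proof.
move=> K_ge0 covS discS.
have [c [Sc c_r]] := covS 0.
have r_ge0 : 0 <= r := le_trans (enorm_ge0 _) c_r.
have c_ge0 := enorm_ge0 c.
(* Large enough for the covering radius and for the error [s1 + s2 - s3 - c] at the end of the
   second trail. *)
pose K1 := K + r + enorm c.
pose G0 := diff_set S `&` closed_eball 0 (2 * K1 + 1).
have finG0 : finite_set G0 by exact: uniformly_discrete_finite.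
have finG := finite_image2 (fun x y => x - y) finG0 finG0.
apply: sub_finite_set (finite_image (fun w => c - w)
  (finite_chain_increments (2 * K1) discS finG)).
move=> z [[_ [s1 Ss1 [s2 Ss2 <-]] [s3 Ss3 <-]]].
rewrite /closed_eball /= subr0 => zK.
(* Both trails follow the same vector [w], so the segments cancel in the differences [a i - b i],
   leaving only the two errors. *)
pose w := c - s1; pose n := (Num.trunc (enorm w)).+1.
have wn : enorm w <= n%:R by rewrite ltW // truncnS_gt.
have rK1 : r <= K1 by rewrite /K1; lra.
have c_end : enorm (c - (s1 + w)) <= K1.
  by rewrite /w subrKC subrr -(scale0r 0) enormZ normr0 mul0r /K1; lra.
have s2_end : enorm (s2 - (s3 + w)) <= K1.
  have -> : s2 - (s3 + w) = s1 + s2 - s3 - c.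
    by apply/rowP => i; rewrite !mxE; ring.
  by have := ler_enormB (s1 + s2 - s3) c; rewrite /K1; lra.
have [a [aS aK a0 an]] := covers_trail covS rK1 Ss1 Sc c_end (ltn0Sn _ : (0 < n)%N).
have [b [bS bK b0 bn]] := covers_trail covS rK1 Ss3 Ss2 s2_end (ltn0Sn _ : (0 < n)%N).
exists ((c - s2) - (s1 - s3)); last first.
  by apply/rowP => i; rewrite !mxE; ring.
exists (fun i => a i - b i); last by exists n; rewrite a0 b0 an bn.
split=> i; first split.
- by exists (a i) => //; exists (b i).
- rewrite a0 b0.
  have -> : a i - b i - (s1 - s3) =
      (a i - (s1 + (i%:R / n%:R) *: w)) - (b i - (s3 + (i%:R / n%:R) *: w)).
    by apply/rowP => j; rewrite !mxE; ring.
  by apply: le_trans (ler_enormB _ _) _; have := aK i; have := bK i; lra.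
exists (a i.+1 - a i).
  split; first by exists (a i.+1) => //; exists (a i).
  by rewrite /closed_eball /= subr0 (trail_step _ aK wn).
exists (b i.+1 - b i).
  split; first by exists (b i.+1) => //; exists (b i).
  by rewrite /closed_eball /= subr0 (trail_step _ bK wn).
by apply/rowP => j; rewrite !mxE; ring.
Qed.

(** * Counting points and patterns *)

Lemma counting_le_size (T : choiceType) (R : realType) (A : set T) (s : seq T) :
  (forall x, A x -> x \in s) -> (@counting T R A <= (size s)%:R%:E)%E.
Proof.
move=> As; have finA : finite_set A by exact: sub_finite_set As (finite_seq s).
rewrite /counting; case: asboolP => // _; rewrite lee_fin ler_nat.
apply: uniq_leq_size; first exact: fset_uniq.
by move=> x; rewrite in_fset_set // => /set_mem/As.
Qed.

Lemma size_le_counting (T : choiceType) (R : realType) (A : set T) (s : seq T) :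
  uniq s -> (forall x, x \in s -> A x) -> ((size s)%:R%:E <= @counting T R A)%E.
Proof.
move=> s_uniq sA; rewrite /counting; case: asboolP => [finA|_]; last exact: leey.
rewrite lee_fin ler_nat uniq_leq_size // => x xs.
by rewrite in_fset_set // mem_set //; exact: sA.
Qed.

(** Balls of radius [r] around a grid of mesh [3 * r] are disjoint, and each contains a point of
    [S]. *)
Lemma covers_many_points (R : realType) (d : nat) (S : set 'rV[R]_d) (r T : R)
    (N : nat) : 0 < r -> covers S r -> (3 * d%:R * N%:R + 1) * r <= T ->
  exists s : seq 'rV[R]_d, [/\ uniq s, size s = (N ^ d)%N &
    forall x, x \in s -> (S `&` closed_eball 0 T) x].
Proof.
move=> r_gt0 covS rT.
pose u (f : {ffun 'I_d -> 'I_N}) : 'rV[R]_d := \row_i (3 * r * (f i)%:R).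
have /choice[p pP] f : exists x, (S `&` closed_eball (u f) r) x by exact: covS.
have u_le f : enorm (u f) <= d%:R * (3 * r * N%:R).
  apply: enorm_le_coord => i; rewrite mxE ger0_norm; last first.
    by rewrite !mulr_ge0 ?ler0n // ltW.
  by rewrite ler_pM2l ?mulr_gt0 // ler_nat ltnW.
exists [seq p f | f <- enum {ffun 'I_d -> 'I_N}]; split.
- rewrite map_inj_uniq ?enum_uniq // => f g pfg; apply/ffunP => i.
  have [[_ pf] [_ pg]] := (pP f, pP g).
  have : `|(u f - u g) ord0 i| <= 2 * r.
    apply: le_trans (coord_le_enorm _ _) _.
    apply: le_trans (ler_enorm_distD (p f) _ _) _.
    by rewrite enormB {2}pfg; move: pf pg; rewrite /closed_eball /=; lra.
  rewrite !mxE ler_norml => /andP[lo hi]; apply: val_inj => /=.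
  case: (ltngtP (f i) (g i)) => // fg; exfalso.
  + have : 0 <= r * ((g i)%:R - (f i)%:R - 1).
      by rewrite mulr_ge0 ?(ltW r_gt0) // -addrA -opprD subr_ge0 natr1 ler_nat.
    by lra.
  + have : 0 <= r * ((f i)%:R - (g i)%:R - 1).
      by rewrite mulr_ge0 ?(ltW r_gt0) // -addrA -opprD subr_ge0 natr1 ler_nat.
    by lra.
- by rewrite size_map -cardE card_ffun !card_ord.
- move=> x /mapP[f _ ->]; have [Spf pf] := pP f; split=> //.
  apply: le_trans rT; apply: le_trans (ler_enorm_distD (u f) _ _) _.
  by rewrite subr0; move: pf (u_le f); rewrite /closed_eball /=; lra.
Qed.

Lemma shiftP (R : realType) (d : nat) (S : set 'rV[R]_d) (t x : 'rV[R]_d) :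
  Defs.shift S t x <-> S (x + t).
Proof.
split=> [[s Ss <-]|Sxt]; first by rewrite subrK.
by exists (x + t) => //; rewrite addrK.
Qed.

Lemma pattern_complexity_le (R : realType) (d : nat) (S : set 'rV[R]_d)
    (r T : R) (U : seq 'rV[R]_d) (P : seq (set 'rV[R]_d)) :
  0 <= r -> r <= T -> covers S r ->
  (forall u, (sum_diff_set S `&` closed_eball 0 r) u -> u \in U) ->
  (forall s, S s -> Defs.shift S s `&` closed_eball 0 (T + r) \in P) ->
  (pattern_complexity S (patch_support S r T) <=
    (1 + size U * size P)%:R%:E)%E.
Proof.
move=> r_ge0 rT covS UP SP; set D := patch_support S r T.
(* [F u p] recovers the pattern at [t] from the patch [p] at the point [t + u] of [S]. *)
pose F (u : 'rV[R]_d) (p : set 'rV[R]_d) := [set h | D h /\ p (h - u)].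
have -> : (1 + size U * size P)%N =
    size (set0 :: [seq F u p | u <- U, p <- P]) by rewrite /= size_allpairs.
apply: counting_le_size => _ [t _ <-]; rewrite inE.
have [->|/set0P[h [/shiftP Sht Dh]]] := eqVneq (Defs.shift S t `&` D) set0.
  by [].
rewrite /=.
suff [u [uU u_r] Sut] : exists2 u,
    (sum_diff_set S `&` closed_eball 0 r) u & S (t + u).
  have -> : Defs.shift S t `&` D = F u (Defs.shift S (t + u) `&` closed_eball 0 (T + r)).
    apply/seteqP; split=> x /=.
      move=> [/shiftP Sxt Dx]; split=> //; split.
        by apply/shiftP; rewrite addrCA subrK addrC.
      move: u_r; rewrite /closed_eball /= !subr0 => u_r.
      apply: le_trans (ler_enormB _ _) _.
      by case: Dx => -[_]; rewrite /closed_eball /= subr0; lra.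
    move=> [Dx [/shiftP + _]]; rewrite addrCA subrK addrC => Sxt.
    by split=> //; apply/shiftP.
  by apply: allpairs_f; [apply: UP | apply: SP].
case: Dh => [hU|[Sh hT]].
  by exists h => //; rewrite addrC.
have [s [Ss s_r]] := covS t.
(* Since [h] and [h + t] both lie in [S], writing [s - t = s + h - (h + t)] puts this vector in
   [S + S - S]. *)
exists (s - t); last by rewrite subrKC.
split; last by rewrite /closed_eball /= subr0.
exists (s + h); first by exists s => //; exists h.
by exists (h + t) => //; apply/rowP => i; rewrite !mxE; ring.
Qed.

(** * From the vanishing liminf to low complexity *)

(** The lower limit is minus the infimum, over neighbourhoods, of the supremum of [- f]; so that
    supremum over [T > M] is at least 0 and exceeds [- e]. *)
Lemma limf_einf0_lt (R : realType) (f : R -> \bar R) (M e : R) :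
  limf_einf f (pinfty_nbhs R) = 0%E -> 0 < e ->
  exists2 T, M < T & (f T < e%:E)%E.
Proof.
rewrite /limf_einf /limf_esup => /eqP; rewrite oppe_eq0 => /eqP inf0 e_gt0.
pose V := [set T : R | M < T].
have : (0 <= ereal_sup [set (\- f)%E x | x in V])%E.
  by rewrite -inf0; apply: ereal_inf_lbound; exists V => //; exists M; rewrite num_real.
have eN : ((- e)%:E < 0)%E by rewrite lte_fin oppr_lt0.
move=> /(lt_le_trans eN)/ereal_sup_gt[_ [T MT <-]]; rewrite EFinN lteN2 => fT.
by exists T.
Qed.

Theorem theorem5p4 (R : realType) (d : nat) (S : set 'rV[R]_d) (r : R) :
  (1 <= d)%N -> meyer S -> is_covering_radius S r ->
  limf_einf (fun T : R => (patch_count S T * ((T ^+ d)^-1)%:E)%E)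
    (pinfty_nbhs R) = 0%E ->
  exists2 T : R, 0 <= T & low_complexity S (patch_support S r T).
Proof.
move=> d_gt0 [[discS _] [discSS _]] [r_gt0 covS _] liminf0.
have r_ge0 := ltW r_gt0.
have d1 : 1 <= d%:R :> R by rewrite ler1n.
have dr : r <= d%:R * r by rewrite ler_peMl.
have finU := finite_sum_diff_set_ball r_ge0 covS discSS.
pose U : seq 'rV[R]_d := fset_set (sum_diff_set S `&` closed_eball 0 r).
(* The successor absorbs the empty pattern: [1 + #U * n <= m * n] once [n >= 1]. With [N * q <= T'],
   the grid of [N ^ d] balls takes up at most half of [T']; the condition [4 * r < T'] leaves
   [2 * r] in the other half. *)
pose m := (size U).+1; pose q := 6 * (d%:R * r).
have q_gt0 : 0 < q by rewrite /q; lra.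
have e_gt0 : 0 < (m%:R * (2 * q) ^+ d)^-1.
  by rewrite invr_gt0 mulr_gt0 ?ltr0n // exprn_gt0 // mulr_gt0.
have [T' qT' patchT'] := limf_einf0_lt (q + 4 * r) liminf0 e_gt0.
have T'_gt0 : 0 < T' by lra.
(* An infinite patch count would make the quotient [+oo], not a value below a real number. *)
move: patchT'; rewrite /patch_count /counting; case: asboolP => [finP|_]; last first.
  by rewrite gt0_mulye // lte_fin invr_gt0 exprn_gt0.
set P := fset_set _ => patchT'; pose n := size P.
have {}patchT' : m%:R * n%:R <= (T' / (2 * q)) ^+ d.
  move: patchT'; rewrite -EFinM lte_fin ltr_pdivrMr ?exprn_gt0 // => /ltW.
  have q2d_gt0 : 0 < (2 * q) ^+ d by rewrite exprn_gt0 // mulr_gt0.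
  rewrite ler_pdivlMl ?mulr_gt0 ?ltr0n // => patchT'.
  by rewrite expr_div_n ler_pdivlMr // mulrAC.
pose N := Num.trunc (T' / q).
have T'q : 1 <= T' / q by rewrite ler_pdivlMr //; lra.
have /andP[N_le N_gt] : N%:R <= T' / q < N.+1%:R.
  by apply: truncn_itv; lra.
have N_ge1 : 1 <= N%:R :> R by rewrite ler1n -ltnS -(ltr_nat R) (le_lt_trans T'q).
(* As [N >= 1], rounding down loses at most a factor 2: [T' / q < N + 1 <= 2 * N]. *)
have N_ge : T' / (2 * q) <= N%:R.
  have -> : T' / (2 * q) = T' / q / 2 by field; rewrite gt_eqF.
  by rewrite -natr1 in N_gt; lra.
have NT : (3 * d%:R * N%:R + 1) * r <= T' - r.
  by move: N_le; rewrite ler_pdivlMr // /q; lra.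
have [s [s_uniq sz_s sS]] := covers_many_points r_gt0 covS NT.
have [c Sc] : S !=set0 by have [c [Sc _]] := covS 0; exists c.
(* Patterns on this support are read off from patches of radius [(T' - r) + r = T'], the radius at
   which the patch count is small. *)
exists (T' - r); first by lra.
split.
- by rewrite finite_setU; split=> //; apply: uniformly_discrete_finite.
- have [x [Sx x_r]] := covS 0; exists x; right; split=> //.
  by move: x_r; rewrite /closed_eball /=; lra.
have UP u : (sum_diff_set S `&` closed_eball 0 r) u -> u \in U.
  by move=> Uu; rewrite in_fset_set // mem_set.
have SP x : S x -> Defs.shift S x `&` closed_eball 0 (T' - r + r) \in (P : seq _).
  by move=> Sx; rewrite subrK in_fset_set // mem_set //; exists x.
have n_gt0 : (0 < n)%N.
  by rewrite /n; have := SP _ Sc; case: (P : seq _).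
have rT : r <= T' - r by lra.
apply: le_trans (pattern_complexity_le r_ge0 rT covS UP SP) _.
apply: (@le_trans _ _ (size s)%:R%:E); last first.
  by apply: size_le_counting => // x /sS; right.
rewrite lee_fin sz_s natrX.
apply: (@le_trans _ _ (m%:R * n%:R)).
  by rewrite -natrM ler_nat /m mulSn leq_add2r.
apply: le_trans patchT' _; apply: lerXn2r => //; rewrite ?nnegrE ?ler0n //.
by rewrite divr_ge0 ?ltW // mulr_gt0.
Qed.
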